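(* Let $S$ be a finite set with $|S|$ even, let $G$ be a subgroup of the symmetric group of $S$, and let $\mathcal{R}_{G}$ be a $G$-strong antichain. Then $$|\mathcal{R}_{G}| \leq \sum_{[q]\in \mathcal{Q}}\frac{2^{|S|/2}}{|G_{q}|},$$ where $\mathcal{Q}$ is the set of conjugacy classes (under conjugation in $G$) of quasipolarities of $G$.
   Context: Let $S$ be a finite set of even cardinality and $G$ a subgroup of the symmetric group of $S$. The group $G$ acts on subsets of $S$ by $gA:=\{ga : a\in A\}$. A dichotomy is an element of $\binom{S}{|S|/2}:=\{A\subseteq S: |A|=|S|/2\}$. A dichotomy $D$ is $G$-rigid if $gD=D$ with $g\in G$ implies $g=e$; it is $G$-autocomplementary if there exists $p\in G$ with $pD=S\setminus D$; it is $G$-strong if it is both $G$-rigid and $G$-autocomplementary. A traversal $\mathcal{T}$ of the orbit set $\binom{S}{|S|/2}/G$ is a set of dichotomies consisting of exactly one element from each $G$-orbit on $\binom{S}{|S|/2}$. A $G$-strong antichain is a subset $\mathcal{R}_G$ of such a traversal $\mathcal{T}$ all of whose members are $G$-strong. A quasipolarity of $G$ is an involutive derangement $q\in G$, i.e. $q^2=e$ and $q$ fixes no point of $S$. For a quasipolarity $q$, $G_q=\{g\in G: gqg^{-1}=q\}$ denotes the isotropy group of $q$ under the conjugation action of $G$ (its order depends only on the conjugacy class $[q]$). *)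

(* Defs.v *)
From mathcomp Require Import all_boot all_order all_fingroup all_algebra.

Set Implicit Arguments.
Unset Strict Implicit.
Unset Printing Implicit Defensive.

(* MathComp permutations compose left to right: (g * h) x = h (g x).  Hence
   the conjugate written g q g^-1 with right-to-left composition is q ^ g here,
   i.e. g^-1 * q * g. *)

Section StrongDichotomies.

Variable S : finType.
Implicit Types (G : {group {perm S}}) (D : {set S}) (T R : {set {set S}}).

Definition dichotomies : {set {set S}} := [set D : {set S} | #|D| == #|S|./2].

Definition rigid G D : Prop :=
  forall g : {perm S}, g \in G -> g @: D = D -> g = 1%g.

Definition autocomplementary G D : Prop :=
  exists2 p : {perm S}, p \in G & p @: D = ~: D.

Definition strong G D : Prop := rigid G D /\ autocomplementary G D.

(* 'P^* is the action of permutations on subsets by direct image,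
   'P^*%act D g = g @: D. *)
Definition dichotomy_orbits G : {set {set {set S}}} :=
  [set orbit 'P^* G D | D in dichotomies].

Definition traversal G T : Prop :=
  is_transversal T (dichotomy_orbits G) dichotomies.

Definition strong_antichain G R : Prop :=
  exists T, [/\ traversal G T, R \subset T & {in R, forall D, strong G D}].

Definition quasipolarity (q : {perm S}) : bool :=
  (q ^+ 2 == 1)%g && [forall x, q x != x].

Definition quasipolarity_classes G : {set {set {perm S}}} :=
  [set (q ^: G)%g | q in [set q in G | quasipolarity q]].

End StrongDichotomies.

(* Main.v *)
Require Import Defs.
From mathcomp Require Import all_boot all_order all_fingroup all_algebra.

(** An element p of G sending a rigid D to its complement is a quasipolarity:
    p ^+ 2 fixes D, so it is trivial, and p moves every point across the
    partition of S into D and its complement.  So R is covered by the sets R_C,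
    where C runs through the classes of quasipolarities and R_C consists of the
    members of R that some element of C complements.

    To bound #|R_C|, consider the images g @: D with D in R_C and g in G.
    They are pairwise distinct, because members of R lie in distinct orbits and
    are rigid, which makes #|R_C| * #|G| sets; and each of them is complemented
    by some element of C, since conjugation by g carries a permutation
    complementing D to one complementing g @: D.  A single permutation
    complements at most 2 ^ (#|S| / 2) sets ([card_complemented]), so
    #|R_C| * #|G| <= #|C| * 2 ^ (#|S| / 2).  Dividing by #|C|, which is the
    index in G of the centraliser of any element of C, gives the summand of C
    ([card_complemented_by_class]); summing over C gives the theorem. *)

Set Implicit Arguments.
Unset Strict Implicit.
Unset Printing Implicit Defensive.

Section Complementation.

Variable S : finType.
Implicit Types (p q g : {perm S}) (A D : {set S}) (C : {set {perm S}}).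
Implicit Types (G : {group {perm S}}) (R : {set {set S}}).

Definition complemented q : {set {set S}} := [set A : {set S} | q @: A == ~: A].

Definition complemented_by_class R C : {set {set S}} :=
  [set D in R | [exists p in C, D \in complemented p]].

Lemma leq_card_bigcup (T I : finType) (P : pred I) (F : I -> {set T}) :
  #|\bigcup_(i | P i) F i| <= \sum_(i | P i) #|F i|.
Proof.
elim/big_rec2: _ => [|i n A _ leAn]; first by rewrite cards0.
by rewrite (leq_trans (leq_card_setU _ _)) ?leq_add2l.
Qed.

Lemma imset_permM p q A : (p * q)%g @: A = q @: (p @: A).
Proof. by rewrite -imset_comp; apply: eq_imset => x; rewrite /= permM. Qed.

Lemma mem_complemented q A x :
  A \in complemented q -> (q x \in A) = (x \notin A).
Proof.
rewrite inE => /eqP qA; rewrite -[A in LHS]setCK -qA inE mem_imset //.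
exact: perm_inj.
Qed.

Lemma complemented_card q A : A \in complemented q -> #|A| = #|S|./2.
Proof.
rewrite inE => /eqP qA; rewrite -(cardsC A) -qA.
by rewrite (card_imset _ (@perm_inj _ q)) addnn doubleK.
Qed.

(** Fix one set A0 that q complements.  Every point outside A0 is sent into A0
    by q, so a set A complemented by q is determined by its trace on A0; and A0
    has #|S| / 2 elements. *)
Lemma card_complemented q : #|complemented q| <= 2 ^ #|S|./2.
Proof.
have [->|[A0 qA0]] := set_0Vmem (complemented q); first by rewrite cards0.
rewrite -(complemented_card qA0) -card_powerset.
rewrite -(@card_in_imset _ _ (fun A => A :&: A0) (complemented q)).
  apply/subset_leq_card/subsetP => _ /imsetP[A _ ->].
  by rewrite powersetE subsetIr.
move=> A B qA qB /setP eqAB.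
apply/setP => x; have [xA0|xA0] := boolP (x \in A0).
  by have := eqAB x; rewrite !inE xA0 !andbT.
have := eqAB (q x); rewrite !inE (mem_complemented _ qA0) xA0 !andbT.
by rewrite (mem_complemented _ qA) (mem_complemented _ qB) => /negb_inj.
Qed.

(** With left-to-right composition, p ^ g maps g @: A to
    g @: (p @: A) = g @: ~: A. *)
Lemma complemented_conj p g A :
  A \in complemented p -> g @: A \in complemented (p ^ g)%g.
Proof.
rewrite !inE => /eqP pA; rewrite -imset_permM -conjgC imset_permM pA.
apply/eqP/setP => x; rewrite -[x](permKV g) inE.
by rewrite !mem_imset ?inE //; apply: perm_inj.
Qed.

(** Complementing twice fixes D, so rigidity makes p an involution; p has no
    fixed point because no point lies on both sides of the partition. *)
Lemma rigid_complemented_quasipolarity G D p :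
  rigid G D -> p \in G -> D \in complemented p -> quasipolarity p.
Proof.
move=> rigD Gp pD; apply/andP; split.
  apply/eqP/rigD; first exact: groupX.
  apply/setP => x; rewrite expgS expg1 -[x](permKV (p * p)%g).
  rewrite mem_imset; last exact: perm_inj.
  by rewrite permM !(mem_complemented _ pD) negbK.
apply/forallP => x; apply/eqP => px; have := mem_complemented x pD.
by rewrite px; case: (x \in D).
Qed.

(** R lies in a set of representatives that meets each orbit exactly once. *)
Lemma antichain_orbit_inj G R D E g : strong_antichain G R ->
  D \in R -> E \in R -> g \in G -> E = g @: D -> D = E.
Proof.
case=> T [/and3P[_ TD /forall_inP oneT] RT _] RD RE Gg eqE.
have/cards1P[A defA] : #|T :&: orbit 'P^*%act G D| == 1.
  apply/oneT/imset_f/(subsetP TD)/(subsetP RT)/RD.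
have memA F : F \in R -> F \in orbit 'P^*%act G D -> F = A.
  by move=> RF oF; apply/set1P; rewrite -defA inE (subsetP RT).
rewrite (memA D) ?orbit_refl // (memA E) //.
by apply/orbitP; exists g.
Qed.

(** If g @: D = h @: E, then D and E share an orbit, hence are equal, and
    g * h^-1 fixes D, hence is trivial by rigidity. *)
Lemma antichain_image_inj G R : strong_antichain G R ->
  {in setX R G &, injective (fun Dg : {set S} * {perm S} => Dg.2 @: Dg.1)}.
Proof.
move=> hR [D g] [E h] /setXP[/= RD Gg] /setXP[/= RE Gh] eq_gh.
have eqE : E = (g * h^-1)%g @: D.
  rewrite imset_permM eq_gh -imset_permM mulgV.
  by rewrite (eq_imset _ (@perm1 S)) imset_id.
have Ggh : (g * h^-1)%g \in G by rewrite groupM ?groupV.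
have eqDE := antichain_orbit_inj hR RD RE Ggh eqE.
have [T [_ _ /(_ D RD)[rigD _]]] := hR.
congr (_, _) => //; apply/eqP; rewrite eq_mulgV1; apply/eqP/rigD => //.
by rewrite -eqE.
Qed.

(** The pairs (D, g) inject into the union of the sets [complemented p], p in the
    class of q, by (D, g) |-> g @: D.  Comparing cardinals gives the bound
    multiplied by the size of the class. *)
Lemma card_complemented_by_class G R q : strong_antichain G R ->
  #|complemented_by_class R (q ^: G)%g| * #|'C_G[q]%g| <= 2 ^ #|S|./2.
Proof.
move=> hR; set C := (q ^: G)%g; set RC := complemented_by_class R C.
have sRC : {subset setX RC G <= setX R G}.
  by move=> [D g]; rewrite !inE /= => /andP[/andP[-> _] ->].
have C_gt0 : 0 < #|C| by apply/card_gt0P; exists q; apply: class_refl.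
have orbit_stab : #|C| * #|'C_G[q]%g| = #|G|.
  by rewrite -index_cent1 mulnC Lagrange ?subsetIl.
rewrite -(leq_pmul2l C_gt0) mulnCA orbit_stab -cardsX.
rewrite -(card_in_imset (sub_in2 sRC (antichain_image_inj hR))).
apply: (@leq_trans #|\bigcup_(p in C) complemented p|).
  apply/subset_leq_card/subsetP => _ /imsetP[[D g] /setXP[/= RCD Gg] ->].
  move: RCD; rewrite inE => /andP[_ /exists_inP[p Cp pD]].
  apply/bigcupP; exists (p ^ g)%g; last exact: complemented_conj.
  by rewrite /C -(class_eqP Cp) memJ_class.
rewrite -sum_nat_const; apply: leq_trans (leq_card_bigcup _ _) _.
by apply: leq_sum => p _; apply: card_complemented.
Qed.

Lemma strong_antichain_cover G R : strong_antichain G R ->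
  R \subset \bigcup_(C in quasipolarity_classes G) complemented_by_class R C.
Proof.
case=> T [_ _ strongR]; apply/subsetP => D RD.
have [rigD [p Gp pD]] := strongR D RD.
have{}pD : D \in complemented p by rewrite inE pD.
apply/bigcupP; exists (p ^: G)%g.
  by apply: imset_f; rewrite inE Gp (rigid_complemented_quasipolarity rigD).
by rewrite inE RD; apply/exists_inP; exists p; rewrite ?class_refl.
Qed.

End Complementation.

(* For a class C, repr C is an element of C. *)
Theorem theorem2p7 (S : finType) (evenS : ~~ odd #|S|)
    (G : {group {perm S}}) (R : {set {set S}}) (hR : strong_antichain G R) :
  (#|R|%:R <= \sum_(C in quasipolarity_classes G)
      2 ^+ #|S|./2 / #|('C_G[repr C | 'J])%g|%:R :> rat)%R.
Proof.
have leR :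
    #|R| <= \sum_(C in quasipolarity_classes G) #|complemented_by_class R C|.
  apply: leq_trans (subset_leq_card (strong_antichain_cover hR)) _.
  exact: leq_card_bigcup.
move: leR; rewrite -(Num.Theory.ler_nat rat) => /Order.POrderTheory.le_trans.
apply; rewrite GRing.natr_sum; apply: Num.Theory.ler_sum => _ /imsetP[q _ ->].
set r := repr _; have /class_eqP <- : r \in (q ^: G)%g.
  exact: mem_repr (class_refl _ _).
rewrite Num.Theory.ler_pdivlMr ?Num.Theory.ltr0n ?cardG_gt0 //.
rewrite -GRing.natrX -GRing.natrM Num.Theory.ler_nat astab1J.
exact: card_complemented_by_class.
Qed.
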